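(* In the planar $3$-body billiard system ($N=3$ point masses in $\mathbb{R}^2\cong\mathbb{C}$) with equal masses $m_1=m_2=m_3>0$, every billiard trajectory $\ell:\mathbb{R}\to\mathbb{C}^3$ has at most $3$ collisions.
   Context: The configuration space is $E=(\mathbb{R}^2)^3\cong\mathbb{C}^3$ with the real inner product $\langle v,w\rangle=\mathrm{Re}\sum_{a=1}^3 m_a\overline{v_a}w_a$ (the mass metric) and associated norm $\|\cdot\|$. The binary collision subspaces are $\Delta_{ij}=\{(q_1,q_2,q_3)\in\mathbb{C}^3 : q_i=q_j\}$ for $1\le i<j\le 3$. Let $\pi_{\Delta_{ij}}:E\to\Delta_{ij}$ denote orthogonal projection. A billiard trajectory is a continuous, piecewise linear (polygonal) curve $\ell:\mathbb{R}\to E$ of unit speed, all of whose vertices are collisions, i.e. lie in some $\Delta_{ij}$. A collision point (collision) is a time $t^*$ with $\ell(t^* )\in\Delta_{ij}$ for some $i\neq j$. It is assumed that the set of collision points is discrete and that no edge of $\ell$ lies within a collision subspace. At a collision with $\Delta_{ij}$, the velocities $v_-$ and $v_+$ of $\ell$ immediately before and after satisfy $$\|v_-\|=\|v_+\|,\qquad \pi_{\Delta_{ij}}(v_-)=\pi_{\Delta_{ij}}(v_+).$$ If $\ell(t^* )$ lies in more than one collision subspace (triple collision), one of these subspaces is chosen, and the projection condition is imposed only for that choice. The dynamics are non-deterministic: any $v_+$ satisfying these conditions is allowed. The number of collisions is the number of collision points $t^*$. *)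

(* Defs.v *)
From HB Require Import structures.
From mathcomp Require Import all_boot all_order all_algebra.
From mathcomp Require Import all_classical all_reals all_analysis.
From mathcomp Require Import ring lra.
Set Implicit Arguments.
Unset Strict Implicit.
Unset Printing Implicit Defensive.
Import Order.TTheory GRing.Theory Num.Theory.
Import numFieldNormedType.Exports.
Local Open Scope classical_set_scope.
Local Open Scope ring_scope.

(* A configuration q has the position of body a as its row [row a q], a point
   of R^2 = C; so E = (R^2)^3 = C^3 as a real vector space, with its usual
   topology. *)
Definition config (R : realType) := 'M[R]_(3, 2).

Section MassMetric.
Variables (R : realType) (m : 'I_3 -> R).
Implicit Types (v w : config R) (S : set (config R)).

(* In real coordinates, Re (conj z * z') is the dot product of z and z'. *)
Definition mass_dot v w : R := \sum_(a < 3) m a * \sum_(k < 2) v a k * w a k.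

Definition mass_norm v : R := Num.sqrt (mass_dot v v).

Definition is_orth_proj S v w :=
  S w /\ forall u, S u -> mass_dot (v - w) u = 0.

(* The default value 0 is irrelevant for collision subspaces and positive
   masses: see [orth_projP] and [is_orth_proj_unique]. *)
Definition orth_proj S v : config R := xget 0 [set w | is_orth_proj S v w].

End MassMetric.

Definition Delta (R : realType) (i j : 'I_3) : set (config R) :=
  [set q | row i q = row j q].
Arguments Delta : clear implicits.

Section Trajectories.
Variable R : realType.
Implicit Types (l : R -> config R) (t a b : R) (v : config R).

Definition collision_times l : set R :=
  [set t | exists i j : 'I_3, (i < j)%N /\ Delta R i j (l t)].

Definition affine_on l a b :=
  exists p v, forall t, t \in `[a, b] -> l t = p + t *: v.

(* B is a locally finite set of break points. *)
Definition piecewise_linear l :=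
  exists B : set R,
    (forall a b, finite_set (B `&` `[a, b])) /\
    (forall a b, a < b -> B `&` `]a, b[ = set0 -> affine_on l a b).

Definition vertex l t :=
  ~ exists v, \forall s \near t, l s = l t + (s - t) *: v.

Definition velocity_before l t v :=
  \forall s \near t^'-, l s = l t + (s - t) *: v.

Definition velocity_after l t v :=
  \forall s \near t^'+, l s = l t + (s - t) *: v.

(* [bt_no_edge] quantifies over all nondegenerate subsegments of edges: since
   Delta is a linear subspace, it contains an edge as soon as it contains such
   a subsegment.
   In [bt_reflection] the pair (i, j) is the choice made at time t; it is
   forced unless l t is a triple collision. *)
Record billiard_trajectory (m : 'I_3 -> R) l : Prop := BilliardTrajectory {
  bt_continuous : continuous l;
  bt_piecewise_linear : piecewise_linear l;
  bt_unit_speed : forall t v,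
    velocity_before l t v \/ velocity_after l t v -> mass_norm m v = 1;
  bt_vertices : vertex l `<=` collision_times l;
  bt_discrete : collision_times l `<=` isolated (collision_times l);
  bt_no_edge : forall a b (i j : 'I_3), a < b -> affine_on l a b ->
    (i < j)%N -> ~ (l @` `[a, b] `<=` Delta R i j);
  bt_reflection : forall t, collision_times l t ->
    exists i j : 'I_3, [/\ (i < j)%N, Delta R i j (l t) &
      forall vm vp, velocity_before l t vm -> velocity_after l t vp ->
        mass_norm m vm = mass_norm m vp /\
        orth_proj m (Delta R i j) vm = orth_proj m (Delta R i j) vp]
}.

End Trajectories.

Section OrthProj.
Variables (R : realType) (m : 'I_3 -> R).
Implicit Types v w u : config R.

Lemma mass_dot_eq0 v : (forall a, 0 < m a) -> mass_dot m v v = 0 -> v = 0.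
Proof.
move=> m_gt0.
have h0 (a : 'I_3) : 0 <= m a * \sum_(k < 2) v a k * v a k.
  rewrite mulr_ge0 ?(ltW (m_gt0 a))//.
  by apply: sumr_ge0 => k _; rewrite -expr2 sqr_ge0.
move=> /eqP; rewrite psumr_eq0 => [/allP h|a _]; last exact: h0.
apply/matrixP => a k; rewrite mxE.
have := h a; rewrite mem_index_enum mulf_eq0 gt_eqF//= => /(_ isT).
rewrite psumr_eq0 => [/allP /(_ k)|k' _]; last by rewrite -expr2 sqr_ge0.
by rewrite mem_index_enum /= mulf_eq0 orbb => /(_ isT) /eqP.
Qed.

Lemma mass_dotBl v w u : mass_dot m (v - w) u = mass_dot m v u - mass_dot m w u.
Proof.
rewrite /mass_dot -sumrB; apply: eq_bigr => a _.
rewrite -mulrBr -sumrB; congr (_ * _); apply: eq_bigr => k _.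
by rewrite !mxE mulrBl.
Qed.

Lemma is_orth_proj_unique (i j : 'I_3) v w w' : (forall a, 0 < m a) ->
  is_orth_proj m (Delta R i j) v w -> is_orth_proj m (Delta R i j) v w' ->
  w = w'.
Proof.
move=> m_gt0 [Dw hw] [Dw' hw']; apply/eqP; rewrite -subr_eq0; apply/eqP.
apply: (mass_dot_eq0 m_gt0).
have Du : Delta R i j (w - w').
  by rewrite /Delta /= !linearB /= Dw Dw'.
have := hw _ Du; have := hw' _ Du; rewrite !mass_dotBl => h1 h2.
lra.
Qed.

(* The two coordinates of the colliding bodies are replaced by their centre of
   mass. *)
Lemma is_orth_proj_Delta (i j : 'I_3) v :
  (forall a, 0 < m a) -> i != j ->
  is_orth_proj m (Delta R i j) v (\matrix_(a, k)
    (if (a == i) || (a == j) then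
       (m i * v i k + m j * v j k) / (m i + m j) else v a k)).
Proof.
move=> m_gt0 ij; split.
  by apply/rowP => k; rewrite !mxE !eqxx orbT.
move=> u /rowP Du.
rewrite /mass_dot (bigD1 i)//= (bigD1 j) 1?eq_sym//=.
rewrite [X in _ + (_ + X)]big1 ?addr0; last first.
  move=> a /andP[/negPf ai /negPf aj]; rewrite big1 ?mulr0// => k _.
  by rewrite !mxE ai aj /= subrr mul0r.
rewrite !mulr_sumr -big_split big1//= => k _.
have := Du k; rewrite !mxE !eqxx orbT /= => ->.
have : m i + m j != 0 by rewrite gt_eqF// addr_gt0.
by move=> h; field.
Qed.

Lemma orth_projP (i j : 'I_3) v :
  (forall a, 0 < m a) -> i != j ->
  is_orth_proj m (Delta R i j) v (orth_proj m (Delta R i j) v).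
Proof. by move=> m_gt0 ij; apply: xgetPex; eexists; exact: is_orth_proj_Delta. Qed.

End OrthProj.

(* Main.v *)
(* Modulo the centre of mass, a collision preserves |v| and <q, v>, since the
   velocity jump is orthogonal to the collision plane that contains q.  With
   x = <q, v>, E = |v|^2 and D = E |q|^2 - x^2, both E and D are therefore
   constant along the whole trajectory and x is continuous with slope E.  For
   two points q, q' of one flight E <q, q'> = x x' + D, so the angle between them
   is the angle between (x, sqrt D) and (x', sqrt D) in the plane.  Successive
   collisions lie in distinct collision planes, which for equal masses meet at
   60 degrees, so each flight turns by at least a third of a half turn; but
   points moving along a horizontal line turn by strictly less than a half turn,
   hence there are at most two flights between collisions. *)
Require Import Defs.
From mathcomp Require Import all_boot all_order all_algebra.
From mathcomp Require Import all_classical all_reals all_analysis.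
From mathcomp Require Import ring lra.
Import Order.TTheory GRing.Theory Num.Theory.
Import numFieldNormedType.Exports.
Local Open Scope classical_set_scope.
Local Open Scope ring_scope.

Set Implicit Arguments.
Unset Strict Implicit.
Unset Printing Implicit Defensive.

(** * Locally affine functions on an interval *)

Lemma locally_affine_is_derive (R : realType) (f : R -> R) (t v : R) :
  (\forall s \near t, f s = f t + (s - t) * v) ->
  \forall s \near t, is_derive (s : R) (1 : R) f v.
Proof.
move=> ftv; have := near_join ftv.
apply: filterS => s fs.
have dg : is_derive s (1 : R) (fun u => f t + (u - t) * v) v.
  apply: is_derive_eq; rewrite /GRing.scale/=; ring.
apply: near_eq_is_derive dg.
by move: fs; apply: filterS => u ->.
Qed.

(** The derivative is locally constant, so the mean value theorem applied to it makes it constant on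
    the open interval; applied to [f], it extends the affine formula to the end points by
    continuity. *)
Lemma locally_affine_segment (R : realType) (f : R -> R) (a b : R) : a < b ->
  {within `[a, b], continuous f} ->
  (forall t, t \in `]a, b[ ->
    exists v, \forall s \near t, f s = f t + (s - t) * v) ->
  forall t, t \in `[a, b] -> f t = f a + (t - a) * ((f b - f a) / (b - a)).
Proof.
move=> ab cf laf.
have df t : t \in `]a, b[ -> is_derive t (1 : R) f ('D_1 f t).
  move=> /laf [v /locally_affine_is_derive /nbhs_singleton dv].
  by apply: (is_derive_eq dv); rewrite (@derive_val _ _ _ _ _ _ _ dv).
have ddf t : t \in `]a, b[ -> is_derive t (1 : R) ('D_1 f) 0.
  move=> /laf [v /locally_affine_is_derive fv].
  apply: near_eq_is_derive (is_derive_cst v t (1 : R)).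
  by move: fv; apply: filterS => s ds; rewrite (@derive_val _ _ _ _ _ _ _ ds).
have cst (s t : R) : s \in `]a, b[ -> t \in `]a, b[ -> s < t ->
    'D_1 f s = 'D_1 f t.
  rewrite !in_itv /= => /andP[as_ sb] /andP[at_ tb] st.
  have sub u : u \in `[s, t] -> u \in `]a, b[.
    rewrite !in_itv /= => /andP[su ut].
    by rewrite (lt_le_trans as_ su) (le_lt_trans ut tb).
  have ds u : u \in `]s, t[ -> is_derive u (1 : R) ('D_1 f) 0.
    by move=> /subset_itv_oo_cc /sub; exact: ddf.
  have cs : {within `[s, t], continuous ('D_1 f)}.
    apply: derivable_within_continuous => u /sub /ddf dfu.
    exact: (@ex_derive _ _ _ _ _ _ _ dfu).
  have [c _] := MVT_segment (ltW st) ds cs.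
  by rewrite mul0r => /eqP; rewrite subr_eq0 => /eqP.
have {}cst (s t : R) : s \in `]a, b[ -> t \in `]a, b[ -> 'D_1 f s = 'D_1 f t.
  by move=> hs ht; case: (ltgtP s t) => [/cst|/cst|->] // ->.
have [c0 hc0 fab] := MVT ab df cf.
move=> t; rewrite in_itv /= => /andP[at_ tb].
have ba : b - a != 0 by rewrite subr_eq0 gt_eqF.
rewrite fab mulfK//.
move: at_; rewrite le_eqVlt => /orP[/eqP <-|at_].
  by rewrite subrr mul0r addr0.
have da u : u \in `]a, t[ -> is_derive u (1 : R) f ('D_1 f u).
  rewrite in_itv /= => /andP[au ut]; apply: df.
  by rewrite in_itv /= au (lt_le_trans ut).
have ca : {within `[a, t], continuous f}.
  by apply: continuous_subspaceW cf; apply: subset_itvl; rewrite bnd_simp.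
have [c hc fat] := MVT at_ da ca.
rewrite (cst c0 c hc0); last first.
  by move: hc; rewrite !in_itv /= => /andP[-> ct]; exact: lt_le_trans tb.
by rewrite mulrC -fat addrC subrK.
Qed.

(** * Collision times as a set of reals *)

Lemma closed_Delta (R : realType) (i j : 'I_3) : closed (Delta R i j).
Proof.
have -> : Delta R i j =
    \bigcap_(k in [set: 'I_2]) [set q : config R | q i k - q j k = 0].
  apply/seteqP; split => q /=.
    move=> /rowP qij k _.
    by have := qij k; rewrite !mxE => /= ->; rewrite subrr.
  move=> qij; apply/rowP => k; rewrite !mxE.
  by apply/eqP; rewrite -subr_eq0; apply/eqP; apply: qij.
apply: closed_bigI => k _.
apply: (@preimage_closed _ _ (fun q : config R => q i k - q j k)
  [set x | x = 0]).
  by move=> q _; apply: continuousB; exact: coord_continuous.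
exact: closed_eq.
Qed.

Lemma closed_collision_times (R : realType) (l : R -> config R) :
  continuous l -> closed (collision_times l).
Proof.
move=> cl.
have -> : collision_times l =
  \bigcup_(p in [set p : 'I_3 * 'I_3 | (p.1 < p.2)%N])
    l @^-1` Delta R p.1 p.2.
  apply/seteqP; split => t /=.
    by move=> [i [j [ij lt]]]; exists (i, j).
  by move=> [[i j] /= ij lt]; exists i, j.
apply: closed_bigcup => [|p _]; first exact: finite_finset.
apply: (@preimage_closed _ _ l); last exact: closed_Delta.
by move=> t _; exact: cl.
Qed.

(** Isolation leaves a gap after [a]; beyond the gap and up to [c], the set [A] is compact and
    attains its minimum. *)
Lemma closed_isolated_next (R : realType) (A : set R) (a c : R) :
  closed A -> A `<=` isolated A -> A a -> A c -> a < c ->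
  exists b, [/\ A b, a < b, b <= c & forall t, A t -> a < t -> b <= t].
Proof.
move=> clA isoA Aa Ac ac.
have [_ [V [e /= e0 eV] VA]] := isoA _ Aa.
have gap t : A t -> a < t -> a + e <= t.
  move=> At at_; rewrite leNgt; apply/negP => tae.
  suff : [set a] t by move=> /= ta; rewrite ta ltxx in at_.
  rewrite -VA; split => //; apply: eV => /=.
  by rewrite distrC ger0_norm ?subr_ge0 ?ltW// ltrBlDl.
have [|||b] := @compact_EVT_min R R id (`[a + e, c] `&` A).
- by exists c; split => //=; rewrite in_itv /= lexx gap.
- by apply: compact_closedI => //; exact: segment_compact.
- by apply: continuous_subspaceT => x; exact: cvg_id.
- rewrite inE /= in_itv /= => -[/andP[aeb bc] Ab bmin].
  exists b; split => //; first by rewrite (lt_le_trans _ aeb)// ltrDl.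
  move=> t At at_; have [tc|ct] := leP t c; last exact: le_trans bc (ltW ct).
  by apply: bmin; rewrite inE /=; split => //=; rewrite in_itv /= gap.
Qed.

Lemma card_le_chain (R : realType) (A : set R) :
  (forall t1 t2 t3 t4, A t1 -> A t2 -> A t3 -> A t4 ->
    t1 < t2 -> t2 < t3 -> t3 < t4 -> False) ->
  (A #<= `I_3)%card.
Proof.
move=> noA.
have noS (s : seq R) : uniq s -> (forall x, x \in s -> A x) -> (size s <= 3)%N.
  move=> us sA; rewrite leqNgt; apply/negP => s4.
  pose t := sort <=%O s.
  have st : size t = size s by rewrite size_sort.
  have lts : sorted <%O t.
    by rewrite lt_sorted_uniq_le sort_uniq us sort_le_sorted.
  have tA i : (i < 4)%N -> A (nth 0 t i).
    move=> i4; apply: sA.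
    by rewrite -(mem_sort <=%O) mem_nth// st (leq_trans i4).
  have tlt i : (i < 3)%N -> nth 0 t i < nth 0 t i.+1.
    move=> i3; apply: (sortedP 0 lts); rewrite st; exact: leq_trans s4.
  exact: (noA _ _ _ _ (tA 0%N _) (tA 1%N _) (tA 2%N _) (tA 3%N _)
    (tlt 0%N _) (tlt 1%N _) (tlt 2%N _)).
have [/finite_setP [n An]|infA] := pselect (finite_set A).
  rewrite (card_le_eql An) card_le_II -(card_fset_set An); apply: noS => [|x].
    exact: finmap.fset_uniq.
  by rewrite in_fset_set ?inE//; exists n.
have [B BA] := infinite_set_fset 4 infA.
rewrite leqNgt ltnS => /negP[]; apply: noS => [|x xB].
  exact: finmap.fset_uniq.
exact: BA.
Qed.

(** * Geometry modulo the centre of mass *)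

(* The inner product of the relative motion: up to a constant factor, the mass
   metric for equal masses after removal of the centre of mass. *)
Definition rel_dot (R : realType) (q w : config R) : R :=
  \sum_(a < 3) \sum_(b < 3) \sum_(k < 2) (q a k - q b k) * (w a k - w b k).

Lemma rel_dotC (R : realType) (q w : config R) : rel_dot q w = rel_dot w q.
Proof. by do 3! [apply: eq_bigr => ? _]; rewrite mulrC. Qed.

Lemma rel_dotDr (R : realType) (q w w' : config R) :
  rel_dot q (w + w') = rel_dot q w + rel_dot q w'.
Proof.
do 3! [rewrite -big_split; apply: eq_bigr => ? _].
by rewrite !mxE /=; ring.
Qed.

Lemma rel_dotZr (R : realType) (c : R) (q w : config R) :
  rel_dot q (c *: w) = c * rel_dot q w.
Proof.
do 3! [rewrite mulr_sumr; apply: eq_bigr => ? _].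
by rewrite !mxE; ring.
Qed.

Lemma rel_dot_ge0 (R : realType) (v : config R) : 0 <= rel_dot v v.
Proof. by do 3! [apply: sumr_ge0 => ? _]; rewrite -expr2 sqr_ge0. Qed.

Lemma rel_dot_eq0 (R : realType) (v : config R) (i j : 'I_3) :
  rel_dot v v = 0 -> Delta R i j v.
Proof.
have ge0 a b : 0 <= \sum_(k < 2) (v a k - v b k) * (v a k - v b k).
  by apply: sumr_ge0 => k _; rewrite -expr2 sqr_ge0.
move=> /psumr_eq0P v0; apply/rowP => k; rewrite !mxE.
have /psumr_eq0P vi0 := v0 (fun a _ => sumr_ge0 _ (fun b _ => ge0 a b)) i isT.
have /psumr_eq0P vij0 := vi0 (fun b _ => ge0 i b) j isT.
apply/eqP; rewrite -subr_eq0 -sqrf_eq0 expr2 vij0// => k' _.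
by rewrite -expr2 sqr_ge0.
Qed.

Lemma rel_dot_cauchy (R : realType) (q v : config R) : 0 < rel_dot v v ->
  rel_dot q v ^+ 2 <= rel_dot v v * rel_dot q q.
Proof.
move=> v0.
(* This vector is |v|^2 times the component of [q] orthogonal to [v]. *)
have := rel_dot_ge0 (rel_dot v v *: q + (- rel_dot q v) *: v).
rewrite rel_dotDr !rel_dotZr ![rel_dot (_ + _) _]rel_dotC !rel_dotDr !rel_dotZr.
rewrite (rel_dotC v q) => h.
by rewrite -subr_ge0 -(pmulr_rge0 _ v0); lra.
Qed.

Lemma sum_I3 (V : nmodType) (F : 'I_3 -> V) (i j k : 'I_3) :
  i != j -> j != k -> i != k -> \sum_a F a = F i + F j + F k.
Proof.
move=> ij jk ik; rewrite (bigD1 i)//= (bigD1 j) 1?eq_sym//= (bigD1 k)/=.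
  rewrite big1 ?addr0 ?addrA// => a /andP[/andP[]].
  by move: i j k a ij jk ik =>
    [[|[|[|?]]]?] [[|[|[|?]]]?] [[|[|[|?]]]?] [[|[|[|?]]]?].
by rewrite ![k == _]eq_sym ik jk.
Qed.

(** Lagrange's identity. It isolates the Euclidean product and the coordinate totals, which is where
    conservation of energy and momentum enters. *)
Lemma rel_dot_coord (R : realType) (q w : config R) :
  rel_dot q w = 2 * (3 * \sum_(a < 3) \sum_(k < 2) q a k * w a k -
    \sum_(k < 2) (\sum_(a < 3) q a k) * (\sum_(a < 3) w a k)).
Proof. by rewrite /rel_dot !big_ord_recl !big_ord0; ring. Qed.

(* Modulo the centre of mass, distinct collision planes meet at 60 degrees; the
   inequality is [|cos| <= 1/2]. *)
Lemma Delta_rel_dot_le (R : realType) (i j k : 'I_3) (q w : config R) :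
  i != j -> j != k -> i != k -> Delta R i j q -> Delta R j k w ->
  4 * rel_dot q w ^+ 2 <= rel_dot q q * rel_dot w w.
Proof.
move=> ij jk ik /rowP qij /rowP wjk.
have {}qij h : q i h = q j h by have := qij h; rewrite !mxE.
have {}wjk h : w j h = w k h by have := wjk h; rewrite !mxE.
rewrite /rel_dot !(sum_I3 _ ij jk ik) !big_ord_recl !big_ord0 !qij !wjk.
set z0 := lift _ _.
(* With A = q_k - q_j and B = w_i - w_k, the products are <q, w> = -2 A.B, <q, q> = 4 |A|^2 and <w,
   w> = 4 |B|^2. The claim is Cauchy-Schwarz in the plane, whose defect is the square of det(A,
   B). *)
have := sqr_ge0 ((q k ord0 - q j ord0) * (w i z0 - w k z0) -
  (q k z0 - q j z0) * (w i ord0 - w k ord0)).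
lra.
Qed.

(** Two distinct pairs among three bodies share exactly one body; the cases are the possible
    positions of the shared one. *)
Lemma Delta_neq_rel_dot_le (R : realType) (i j i' j' : 'I_3) (q w : config R) :
  (i < j)%N -> (i' < j')%N -> (i, j) != (i', j') ->
  Delta R i j q -> Delta R i' j' w ->
  4 * rel_dot q w ^+ 2 <= rel_dot q q * rel_dot w w.
Proof.
move=> ij ij' nij qij wij'.
have neq (a b : 'I_3) : (a < b)%N -> a != b by rewrite -val_eqE => /ltn_eqF ->.
have sym a b (u : config R) : Delta R a b u -> Delta R b a u by exact: esym.
have neq' (a b : 'I_3) : (a < b)%N -> b != a by move=> /neq; rewrite eq_sym.
have [ei|ni] := eqVneq i i'.
  subst i'; have jj' : j != j' by apply: contra nij => /eqP ->.
  exact: Delta_rel_dot_le (neq' _ _ ij) (neq _ _ ij') jj' (sym _ _ _ qij) wij'.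
have [ej|nj] := eqVneq j j'.
  subst j'.
  exact: Delta_rel_dot_le (neq _ _ ij) (neq' _ _ ij') ni qij (sym _ _ _ wij').
have [eji|nji] := eqVneq j i'.
  subst i'; have ij'' := ltn_trans ij ij'.
  exact: Delta_rel_dot_le (neq _ _ ij) (neq _ _ ij') (neq _ _ ij'') qij wij'.
have [eij|nij'] := eqVneq i j'.
  subst j'; have ij'' := ltn_trans ij' ij.
  exact: Delta_rel_dot_le (neq' _ _ ij) (neq' _ _ ij') (neq' _ _ ij'')
    (sym _ _ _ qij) (sym _ _ _ wij').
exfalso; move: i j i' j' ij ij' ni nj nji nij' {neq neq' nij qij wij'}.
by move=> [[|[|[|?]]]?] [[|[|[|?]]]?] [[|[|[|?]]]?] [[|[|[|?]]]?].
Qed.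

(** * Conservation laws at a collision *)

Lemma orth_proj_eq_orthogonal (R : realType) (m : 'I_3 -> R) (i j : 'I_3)
    (v w u : config R) : (forall a, 0 < m a) -> i != j ->
  orth_proj m (Delta R i j) v = orth_proj m (Delta R i j) w ->
  Delta R i j u -> mass_dot m v u = mass_dot m w u.
Proof.
move=> m0 ij vw Du.
have [_ /(_ u Du)] := orth_projP v m0 ij.
have [_ /(_ u Du)] := orth_projP w m0 ij.
by rewrite vw !mass_dotBl => h1 h2; lra.
Qed.

Lemma mass_norm_eq_dot (R : realType) (m : 'I_3 -> R) (v w : config R) :
  (forall a, 0 < m a) -> mass_norm m v = mass_norm m w ->
  mass_dot m v v = mass_dot m w w.
Proof.
move=> m0.
have ge0 u : 0 <= mass_dot m u u.
  apply: sumr_ge0 => a _; rewrite (mulr_ge0 (ltW (m0 a)))//.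
  by apply: sumr_ge0 => k _; rewrite -expr2 sqr_ge0.
by move=> /(congr1 (fun x => x ^+ 2)); rewrite !sqr_sqrtr.
Qed.

(** The velocity jump is orthogonal to the collision plane. That plane contains the translations, so
    total momentum is kept, and it contains [q]; equal masses turn the mass metric into a multiple
    of the Euclidean product. *)
Lemma reflection_rel_dot (R : realType) (m : 'I_3 -> R) (i j : 'I_3)
    (q v w : config R) :
  (forall a, 0 < m a) -> (forall a b, m a = m b) -> i != j -> Delta R i j q ->
  mass_norm m v = mass_norm m w ->
  orth_proj m (Delta R i j) v = orth_proj m (Delta R i j) w ->
  rel_dot v v = rel_dot w w /\ rel_dot q v = rel_dot q w.
Proof.
move=> m0 meq ij qij vw_norm vw_proj.
have meqd u u' :
    mass_dot m u u' = m 0 * \sum_(a < 3) \sum_(k < 2) u a k * u' a k.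
  by rewrite mulr_sumr; apply: eq_bigr => a _; rewrite (meq a 0).
have mI := mulfI (lt0r_neq0 (m0 0)).
have orth u : Delta R i j u -> \sum_(a < 3) \sum_(k < 2) v a k * u a k =
    \sum_(a < 3) \sum_(k < 2) w a k * u a k.
  move=> /(orth_proj_eq_orthogonal m0 ij vw_proj); rewrite !meqd; exact: mI.
have centre k : \sum_(a < 3) v a k = \sum_(a < 3) w a k.
  have := orth (\matrix_(_, h) (h == k)%:R).
  have E (u : config R) : \sum_(a < 3) \sum_(h < 2) u a h *
      (\matrix_(_, h) (h == k)%:R : config R) a h = \sum_(a < 3) u a k.
    apply: eq_bigr => a _; rewrite (bigD1 k)//=.
    rewrite big1 ?addr0 ?mxE ?eqxx ?mulr1// => h hk.
    by rewrite mxE (negPf hk) mulr0.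
  by rewrite !E; apply; apply/rowP => h; rewrite !mxE.
have energy : \sum_(a < 3) \sum_(k < 2) v a k * v a k =
    \sum_(a < 3) \sum_(k < 2) w a k * w a k.
  by have := mass_norm_eq_dot m0 vw_norm; rewrite !meqd; exact: mI.
split.
  rewrite !rel_dot_coord energy; congr (_ * (_ - _)).
  by apply: eq_bigr => k _; rewrite centre.
rewrite ![rel_dot q _]rel_dotC !rel_dot_coord orth//; congr (_ * (_ - _)).
by apply: eq_bigr => k _; rewrite centre.
Qed.

(** * Turning angles along a horizontal line *)

(* Viewed from the origin, the points [(x_i, h)] of a horizontal line in the
   plane subtend less than a half turn, so no three consecutive angles can all
   be at least 60 degrees ([k] is [sqrt 3]). *)
Lemma third_turns_exceed_half (R : realType) (k h x1 x2 x3 x4 : R) :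
  0 <= k -> k ^+ 2 = 3 -> 0 <= h -> x1 < x2 -> x2 < x3 -> x3 < x4 ->
  k * (x1 * x2 + h ^+ 2) <= h * (x2 - x1) ->
  k * (x2 * x3 + h ^+ 2) <= h * (x3 - x2) ->
  k * (x3 * x4 + h ^+ 2) <= h * (x4 - x3) -> False.
Proof.
move=> k0 k3 h0 x12 x23 x34 H1 H2 H3.
have {}k0 : 0 < k by nra.
move: h0; rewrite le_eqVlt => /orP[/eqP h0|h0].
  (* The line passes through the origin: consecutive points have products at most 0, which no sign
     of [x2] allows. *)
  move: H1 H2 H3; rewrite -h0 !mul0r !expr0n /= !addr0.
  rewrite !(pmulr_rle0 _ k0) => H1 H2 H3.
  case: (ltgtP x2 0) => [x2_lt0|x2_gt0|x2_eq0].
  - have : 0 < x1 * x2 by rewrite nmulr_rgt0// (lt_trans x12).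
    by rewrite ltNge H1.
  - have : 0 < x2 * x3 by rewrite mulr_gt0// (lt_trans x2_gt0).
    by rewrite ltNge H2.
  - have x3_gt0 : 0 < x3 by rewrite -x2_eq0.
    have : 0 < x3 * x4 by rewrite mulr_gt0// (lt_trans x3_gt0).
    by rewrite ltNge H3.
(* The polar angle decreases from 180 to 0 degrees, so a turn of at least 60 starts above 60 and
   ends below 120. *)
have up (x x' : R) : x < x' -> k * (x * x' + h ^+ 2) <= h * (x' - x) ->
    k * x < h /\ - h < k * x'.
  move=> xx' H; split; rewrite ltNge; apply/negP => hx.
    have x0 : 0 < x by rewrite -(pmulr_rgt0 _ k0); apply: lt_le_trans hx.
    have : 0 < k * h ^+ 2 by rewrite mulr_gt0// exprn_gt0.
    have : 0 <= (k * x - h) * x'.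
      by rewrite mulr_ge0 ?subr_ge0// ltW// (lt_trans x0).
    have : 0 < h * x by rewrite mulr_gt0.
    lra.
  have x0 : x' < 0.
    by rewrite -(pmulr_rlt0 _ k0); apply: le_lt_trans hx _; rewrite oppr_lt0.
  have : 0 < k * h ^+ 2 by rewrite mulr_gt0// exprn_gt0.
  have : 0 <= (k * x' + h) * x by apply: mulr_le0; lra.
  have : 0 < h * - x' by rewrite mulr_gt0// oppr_gt0.
  lra.
(* The middle turn thus starts below 120 and ends above 60 degrees: it is too short. *)
have [_ x2h] := up _ _ x12 H1.
have [x3h _] := up _ _ x34 H3.
have [x2h' x3h'] := up _ _ x23 H2.
have : k * (k * (x2 * x3 + h ^+ 2)) <= k * (h * (x3 - x2)) by rewrite ler_pM2l.
(* The sum of these two products gives 3 x2 x3 > - h^2; the turn bound and (h + k x2)(h - k x3) > 0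
   give the opposite. *)
have : 0 < (h - k * x2) * (h - k * x3) by rewrite mulr_gt0// subr_gt0.
have : 0 < (h + k * x2) * (h + k * x3) by rewrite mulr_gt0// -ltrBlDl sub0r.
have : k * (k * (x2 * x3 + h ^+ 2)) = k ^+ 2 * (x2 * x3 + h ^+ 2) by ring.
rewrite k3.
nra.
Qed.

(** Since (x^2 + h^2)(x'^2 + h^2) = (x x' + h^2)^2 + h^2 (x' - x)^2, the hypothesis reads 3 cos^2 <=
    sin^2 for the angle turned, whose sine is nonnegative. *)
Lemma turn_ge_third (R : realType) (k h x x' : R) :
  0 <= k -> k ^+ 2 = 3 -> 0 <= h -> x < x' ->
  4 * (x * x' + h ^+ 2) ^+ 2 <= (x ^+ 2 + h ^+ 2) * (x' ^+ 2 + h ^+ 2) ->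
  k * (x * x' + h ^+ 2) <= h * (x' - x).
Proof.
move=> k0 k3 h0 xx' H.
have hx : 0 <= h * (x' - x) by rewrite mulr_ge0// subr_ge0 ltW.
rewrite leNgt; apply/negP => lt_hx.
have : (h * (x' - x)) ^+ 2 < (k * (x * x' + h ^+ 2)) ^+ 2.
  by rewrite ltr_pXn2r// nnegrE// ltW// (le_lt_trans hx).
rewrite [(k * _) ^+ 2]exprMn k3.
nra.
Qed.

(** * Flights between consecutive collisions *)

Lemma Delta_lin (R : realType) (i j : 'I_3) (q w : config R) (c : R) :
  Delta R i j q -> Delta R i j w -> Delta R i j (q + c *: w).
Proof.
move=> /rowP qij /rowP wij; apply/rowP => k.
by have := qij k; have := wij k; rewrite !mxE => -> ->.
Qed.

Lemma free_flight (R : realType) (l : R -> config R) (a b : R) : a < b ->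
  continuous l -> vertex l `<=` collision_times l ->
  (forall t, collision_times l t -> a < t -> b <= t) ->
  forall t, t \in `[a, b] -> l t = l a + (t - a) *: ((b - a)^-1 *: (l b - l a)).
Proof.
move=> ab cl vl ncol t tab; apply/matrixP => i k; rewrite !mxE [_^-1 * _]mulrC.
apply: (@locally_affine_segment _ (fun s => l s i k)) => //.
  apply: continuous_subspaceT => s.
  apply: (@continuous_comp _ _ _ l (fun q : config R => q i k)).
    exact: cl.
  exact: coord_continuous.
move=> s; rewrite in_itv /= => /andP[as_ sb].
have [v lv] : exists v, \forall u \near s, l u = l s + (u - s) *: v.
  apply: contrapT => nv; have /vl /ncol := nv.
  by move=> /(_ as_); rewrite leNgt sb.
by exists (v i k); move: lv; apply: filterS => u ->; rewrite !mxE.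
Qed.

Lemma velocity_after_segment (R : realType) (l : R -> config R) (a b : R)
    (v : config R) : a < b ->
  (forall t, t \in `[a, b] -> l t = l a + (t - a) *: v) -> velocity_after l a v.
Proof.
move=> ab lab; near=> t; apply: lab; rewrite in_itv /=; apply/andP; split.
  by near: t; exact: nbhs_right_ge.
by near: t; exact: nbhs_right_le.
Unshelve. all: by end_near.
Qed.

Lemma velocity_before_segment (R : realType) (l : R -> config R) (a b : R)
    (v : config R) : a < b ->
  (forall t, t \in `[a, b] -> l t = l a + (t - a) *: v) ->
  velocity_before l b v.
Proof.
move=> ab lab; near=> t.
have -> : l b = l a + (b - a) *: v by apply: lab; rewrite in_itv /= lexx ltW.
have -> : l t = l a + (t - a) *: v.
  apply: lab; rewrite in_itv /=; apply/andP; split.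
    by near: t; exact: nbhs_left_ge.
  by near: t; exact: nbhs_left_le.
by rewrite -[RHS]addrA -scalerDl; congr (_ + _ *: _); ring.
Unshelve. all: by end_near.
Qed.

(** The planes compared at the two ends are any that contain the end points, not the ones chosen in
    [bt_reflection], so triple collisions are covered too. *)
Lemma flight_between_collisions (R : realType) (m : 'I_3 -> R)
    (l : R -> config R) (a b : R) : billiard_trajectory m l -> a < b ->
  collision_times l a -> collision_times l b ->
  (forall t, collision_times l t -> a < t -> b <= t) ->
  exists v, [/\ velocity_after l a v, velocity_before l b v,
    0 < rel_dot v v, l b = l a + (b - a) *: v &
    4 * rel_dot (l a) (l b) ^+ 2 <= rel_dot (l a) (l a) * rel_dot (l b) (l b)].
Proof.
move=> hl ab [i [j [ij la]]] [i' [j' [ij' lb]]] ncol.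
have := free_flight ab (bt_continuous hl) (bt_vertices hl) ncol.
set v := (b - a)^-1 *: _ => lab; exists v.
have lbE : l b = l a + (b - a) *: v by apply: lab; rewrite in_itv /= lexx ltW.
(* Otherwise the whole flight would stay in the plane of [l a]. This excludes both zero relative
   velocity and a return to the same plane. *)
have noedge : ~ Delta R i j v.
  move=> vij.
  apply: (bt_no_edge hl ab _ ij).
    exists (l a - a *: v), v => t /lab ->.
    by rewrite scalerBl addrA addrAC.
  move=> _ [t /= /lab -> <-].
  exact: Delta_lin.
split.
- exact: velocity_after_segment lab.
- exact: velocity_before_segment lab.
- rewrite lt0r rel_dot_ge0 andbT; apply/eqP => v0.
  exact/noedge/rel_dot_eq0.
- exact: lbE.
- apply: (@Delta_neq_rel_dot_le _ i j i' j') => //.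
  apply/eqP => -[ei ej]; subst i' j'; apply: noedge.
  by rewrite /v /Delta /= !linearZ !linearB /= la lb.
Qed.

(* [rel_gram q v / rel_dot v v] is the squared distance from the origin to the
   line [q + s v]. *)
Definition rel_gram (R : realType) (q v : config R) : R :=
  rel_dot v v * rel_dot q q - rel_dot q v ^+ 2.

Lemma rel_dot_line (R : realType) (q v : config R) (s : R) :
  rel_dot (q + s *: v) v = rel_dot q v + s * rel_dot v v.
Proof. by rewrite rel_dotC rel_dotDr rel_dotZr (rel_dotC v q). Qed.

Lemma rel_gram_line (R : realType) (q v : config R) (s : R) :
  rel_gram (q + s *: v) v = rel_gram q v.
Proof.
rewrite /rel_gram rel_dot_line rel_dotDr rel_dotZr rel_dot_line.
by rewrite rel_dotC rel_dotDr rel_dotZr; ring.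
Qed.

(** Up to the factor |v|, the pairs (<q, v>, h) are planar coordinates of the points of the flight:
    [e1], [e2] and [e3] match lengths and inner product. *)
Lemma flight_turn (R : realType) (k h : R) (q v : config R) (s : R) :
  0 <= k -> k ^+ 2 = 3 -> 0 <= h -> h ^+ 2 = rel_gram q v ->
  0 < s -> 0 < rel_dot v v ->
  4 * rel_dot q (q + s *: v) ^+ 2 <=
    rel_dot q q * rel_dot (q + s *: v) (q + s *: v) ->
  rel_dot q v < rel_dot (q + s *: v) v /\
  k * (rel_dot q v * rel_dot (q + s *: v) v + h ^+ 2) <=
    h * (rel_dot (q + s *: v) v - rel_dot q v).
Proof.
move=> k0 k3 h0 hD s0 v0 H.
have xx' : rel_dot q v < rel_dot (q + s *: v) v.
  by rewrite rel_dot_line ltrDl mulr_gt0.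
split=> //; apply: turn_ge_third => //.
have e1 : rel_dot q v ^+ 2 + h ^+ 2 = rel_dot v v * rel_dot q q.
  by rewrite hD /rel_gram; ring.
have e2 : rel_dot (q + s *: v) v ^+ 2 + h ^+ 2 =
    rel_dot v v * rel_dot (q + s *: v) (q + s *: v).
  by rewrite hD -(rel_gram_line q v s) /rel_gram; ring.
have e3 : rel_dot q v * rel_dot (q + s *: v) v + h ^+ 2 =
    rel_dot v v * rel_dot q (q + s *: v).
  by rewrite hD /rel_gram rel_dot_line rel_dotDr rel_dotZr; ring.
by have := ler_wpM2l (sqr_ge0 (rel_dot v v)) H; rewrite e1 e2 e3; lra.
Qed.

(** * Chaining the flights *)

Lemma collision_continuity (R : realType) (m : 'I_3 -> R) (l : R -> config R)
    (t : R) (v w : config R) :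
  (forall a, 0 < m a) -> (forall a b, m a = m b) -> billiard_trajectory m l ->
  collision_times l t -> velocity_before l t v -> velocity_after l t w ->
  rel_dot (l t) v = rel_dot (l t) w /\ rel_gram (l t) v = rel_gram (l t) w.
Proof.
move=> m0 meq hl /(bt_reflection hl) [i [j [ij lt refl]]] tv tw.
have nij : i != j by rewrite -val_eqE ltn_eqF.
have [vw_norm vw_proj] := refl _ _ tv tw.
have [evv eqv] := reflection_rel_dot m0 meq nij lt vw_norm vw_proj.
by rewrite /rel_gram evv eqv.
Qed.

Theorem theorem4p3 (R : realType) (m : 'I_3 -> R)
    (m_gt0 : forall a, 0 < m a) (m_eq : forall a b, m a = m b)
    (l : R -> config R) (hl : billiard_trajectory m l) :
  (collision_times l #<= `I_3)%card.
Proof.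
apply: card_le_chain => t1 t2 t3 t4 c1 c2 c3 c4 t12 t23 t34.
have next := closed_isolated_next (closed_collision_times (bt_continuous hl))
  (bt_discrete hl).
(* The given times need not be consecutive; they are replaced by [t1] and its three successors,
   which exist because each comes no later than the time it replaces. *)
have [n2 [d2 t1n2 n2t2 min2]] := next _ _ c1 c2 t12.
have [n3 [d3 n23 n3t3 min3]] := next _ _ d2 c3 (le_lt_trans n2t2 t23).
have [n4 [d4 n34 _ min4]] := next _ _ d3 c4 (le_lt_trans n3t3 t34).
have [v1 [_ before2 v1_gt0 l2 angle1]] :=
  flight_between_collisions hl t1n2 c1 d2 min2.
have [v2 [after2 before3 v2_gt0 l3 angle2]] :=
  flight_between_collisions hl n23 d2 d3 min3.
have [v3 [after3 _ v3_gt0 l4 angle3]] :=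
  flight_between_collisions hl n34 d3 d4 min4.
have [x2 gram2] := collision_continuity m_gt0 m_eq hl d2 before2 after2.
have [x3 gram3] := collision_continuity m_gt0 m_eq hl d3 before3 after3.
have gram_ge0 : 0 <= rel_gram (l n2) v2 by rewrite subr_ge0 rel_dot_cauchy.
(* One height serves all three flights, as the Gram determinant never changes. *)
pose h := Num.sqrt (rel_gram (l n2) v2).
have h0 : 0 <= h by exact: sqrtr_ge0.
have h2 : h ^+ 2 = rel_gram (l n2) v2 by exact: sqr_sqrtr.
have h1 : h ^+ 2 = rel_gram (l t1) v1.
  by rewrite h2 -gram2 l2 rel_gram_line.
have h3 : h ^+ 2 = rel_gram (l n3) v3.
  by rewrite h2 -gram3 l3 rel_gram_line.
have k0 : 0 <= Num.sqrt 3 :> R by exact: sqrtr_ge0.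
have k3 : Num.sqrt 3 ^+ 2 = 3 :> R by rewrite sqr_sqrtr.
rewrite l2 in angle1; rewrite l3 in angle2; rewrite l4 in angle3.
have pos (a b : R) : a < b -> 0 < b - a by rewrite subr_gt0.
have [lt1 turn1] := flight_turn k0 k3 h0 h1 (pos _ _ t1n2) v1_gt0 angle1.
have [lt2 turn2] := flight_turn k0 k3 h0 h2 (pos _ _ n23) v2_gt0 angle2.
have [lt3 turn3] := flight_turn k0 k3 h0 h3 (pos _ _ n34) v3_gt0 angle3.
(* The end abscissa of each flight is rewritten as the start abscissa of the next. *)
rewrite -l2 x2 in lt1 turn1; rewrite -l3 x3 in lt2 turn2.
exact: third_turns_exceed_half k0 k3 h0 lt1 lt2 lt3 turn1 turn2 turn3.
Qed.
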